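(* Let $R$ be a ring, let $\mathcal{X}$ be a non-empty class of right $R$-modules closed under isomorphisms, and let $M$ be a right $R$-module with a monomorphic $\mathcal{X}$-envelope $u:M\to X$ such that $\mathrm{End}(X)/J(\mathrm{End}(X))$ is a von Neumann regular right self-injective ring and idempotents lift modulo $J(\mathrm{End}(X))$. Let $K$ be the kernel of the ring homomorphism $\varphi:\mathrm{End}(M)\to \mathrm{End}(X)/J(\mathrm{End}(X))$ given by $\varphi(f)=g+J(\mathrm{End}(X))$, where $g\in\mathrm{End}(X)$ is any endomorphism with $g\circ u=u\circ f$. If $M$ is $\mathcal{X}$-automorphism-invariant, then $\mathrm{End}(M)/K$ is von Neumann regular, $K=J(\mathrm{End}(M))$, and idempotents in $\mathrm{End}(M)/J(\mathrm{End}(M))$ lift to idempotents in $\mathrm{End}(M)$.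
   Context: Rings are associative with identity, modules are unital right modules, $J(-)$ is the Jacobson radical. An $\mathcal{X}$-preenvelope of $M$ is a homomorphism $u:M\to X$ with $X\in\mathcal{X}$ such that every homomorphism $M\to X'$ with $X'\in\mathcal{X}$ factors through $u$. It is an $\mathcal{X}$-envelope if, moreover, every endomorphism $h$ of $X$ with $h\circ u=u$ is an automorphism; it is monomorphic if $u$ is a monomorphism. $M$ is $\mathcal{X}$-automorphism-invariant if there is an $\mathcal{X}$-envelope $u:M\to X$ such that for every automorphism $g$ of $X$ there is an endomorphism $f$ of $M$ with $u\circ f=g\circ u$. The homomorphism $\varphi$ is well defined: $g$ exists because $u$ is a preenvelope, and it is unique modulo $J(\mathrm{End}(X))$. *)

(* Defs.v *)
From HB Require Import structures.
From mathcomp Require Import all_boot all_algebra.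
From mathcomp Require Import boolp classical_sets.

Set Implicit Arguments.
Unset Strict Implicit.
Unset Printing Implicit Defensive.

Import GRing.Theory.
Local Open Scope ring_scope.
Local Open Scope classical_set_scope.
Local Open Scope quotient_scope.

(* A right R-module is a left module over the converse ring: a *: x is x.a.   *)
(* All rings are [pzRingType]s: endomorphism rings may be zero.               *)
Notation rmodType R := (lmodType R^c).

Section Ideals.
Variable A : pzRingType.

Definition right_ideal (I : set A) : Prop :=
  [/\ I 0, forall x y, I x -> I y -> I (x + y) & forall x a, I x -> I (x * a)].

Definition maximal_right_ideal (I : set A) : Prop :=
  [/\ right_ideal I, I != setT
    & forall L, right_ideal L -> I `<=` L -> L = I \/ L = setT].

Definition jacobson : set A :=
  [set x | forall I, maximal_right_ideal I -> I x].

Record ideal := Ideal {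
  ideal_set :> A -> Prop;
  ideal_right : right_ideal ideal_set;
  ideal_left : forall a x, ideal_set x -> ideal_set (a * x)
}.

Lemma right_ideal_jacobson : right_ideal jacobson.
Proof.
split=> [I [[]]//|x y Jx Jy I mI|x a Jx I mI].
- by case: (mI) => -[_ ID _] _ _; apply: ID; [exact: Jx|exact: Jy].
- by case: (mI) => -[_ _ IM] _ _; apply: IM; exact: Jx.
Qed.

(* If a is not in the maximal right ideal I, then {s | a s \in I} is again a  *)
(* maximal right ideal.                                                       *)
Lemma jacobson_left a x : jacobson x -> jacobson (a * x).
Proof.
move=> Jx I mI; have [[I0 ID IM] In1 Imax] := mI.
have [Ia|nIa] := pselect (I a); first exact: IM.
apply: (Jx [set s | I (a * s)]); split.
- split=> [|y z /= Iy Iz|y b /= Iy]; first by rewrite /= mulr0.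
    by rewrite mulrDr; apply: ID.
  by rewrite mulrA; apply: IM.
- apply/eqP => E; apply: nIa.
  by have : [set s | I (a * s)] 1; [rewrite E|rewrite /= mulr1].
move=> L [L0 LD LM] sIL.
have [sLI|/existsNP[s /not_implyP[Ls nIas]]] :=
  pselect (forall s, L s -> I (a * s)).
  by left; apply/seteqP.
right; apply/seteqP; split=> // t _.
pose H := [set y | exists b, I (y - a * s * b)].
have sIH : I `<=` H by move=> y Iy; exists 0; rewrite mulr0 subr0.
have [|HI|HT] := Imax H _ sIH.
- split=> [|y z [b Ib] [c Ic]|y b [c Ic]]; first exact: sIH.
  + by exists (b + c); rewrite mulrDr opprD addrACA; apply: ID.
  + by exists (c * b); rewrite mulrA -mulrBl; apply: IM.
- by case: nIas; rewrite -HI; exists 1; rewrite mulr1 subrr.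
have : H (a * t) by rewrite HT.
case=> b; rewrite -mulrA -mulrBr => /sIL Lt.
by rewrite -(subrK (s * b) t); apply: LD => //; apply: LM.
Qed.

Definition jacobson_ideal : ideal := Ideal right_ideal_jacobson jacobson_left.

End Ideals.

Arguments jacobson A : clear implicits.

Section KernelIdeal.
Variables (A B : pzRingType) (f : {rmorphism A -> B}).

Let K : set A := [set x | f x = 0].

Lemma kernel_right : right_ideal K.
Proof.
split=> [|x y /= fx fy|x a /= fx]; first exact: rmorph0.
- by rewrite /K /= rmorphD fx fy addr0.
- by rewrite /K /= rmorphM fx mul0r.
Qed.

Lemma kernel_left a x : K x -> K (a * x).
Proof. by move=> /= fx; rewrite /K /= rmorphM fx mulr0. Qed.

Definition kernel_ideal : ideal A := Ideal kernel_right kernel_left.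

End KernelIdeal.

Section QuotientRing.
Variables (A : pzRingType) (I : ideal A).

Definition ideal_pred : {pred A} := fun x => `[< I x >].

Lemma ideal_zmod_closed : zmod_closed ideal_pred.
Proof.
have [I0 ID IM] := ideal_right I.
split=> [|x y]; first exact/asboolP.
move=> /asboolP Ix /asboolP Iy; apply/asboolP/ID => //.
by rewrite -mulrN1; apply: IM.
Qed.

HB.instance Definition _ := GRing.isZmodClosed.Build A ideal_pred
  ideal_zmod_closed.

Definition quot_ring : Type := Quotient.quot ideal_pred.

HB.instance Definition _ := GRing.Zmodule.on quot_ring.
HB.instance Definition _ := Quotient.on quot_ring.

Local Notation pi := (\pi_quot_ring).

Lemma quot_ringP (x y : A) : pi x = pi y <-> I (x - y).
Proof.
have E := Quotient.idealrBE ideal_pred x y.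
by split=> [/eqP|Ixy]; [rewrite -E => /asboolP|apply/eqP; rewrite -E; apply/asboolP].
Qed.

Let one : quot_ring := pi 1.
Let mul (x y : quot_ring) : quot_ring := pi (repr x * repr y).

Lemma quot_piM (x y : A) : mul (pi x) (pi y) = pi (x * y).
Proof.
have [_ ID IM] := ideal_right I.
apply/quot_ringP; set x' := repr _; set y' := repr _.
have Ix : I (x' - x) by apply/quot_ringP; rewrite reprK.
have Iy : I (y' - y) by apply/quot_ringP; rewrite reprK.
rewrite -(subrKA (x' * y)) -mulrBr -mulrBl; apply: ID; last exact: IM.
exact: ideal_left.
Qed.

Lemma quot_piD (x y : A) : pi (x + y) = pi x + pi y.
Proof. exact: Quotient.pi_add. Qed.

Lemma quotW (P : quot_ring -> Prop) : (forall x, P (pi x)) -> forall x, P x.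
Proof. by move=> Ppi x; rewrite -[x]reprK. Qed.

Let mulA : associative mul.
Proof.
by elim/quotW=> x; elim/quotW=> y; elim/quotW=> z; rewrite !quot_piM mulrA.
Qed.

Let mul1l : left_id one mul.
Proof. by elim/quotW=> x; rewrite quot_piM mul1r. Qed.

Let mul1r : right_id one mul.
Proof. by elim/quotW=> x; rewrite quot_piM mulr1. Qed.

Let mulDl : left_distributive mul +%R.
Proof.
elim/quotW=> x; elim/quotW=> y; elim/quotW=> z.
by rewrite -quot_piD !quot_piM -quot_piD mulrDl.
Qed.

Let mulDr : right_distributive mul +%R.
Proof.
elim/quotW=> x; elim/quotW=> y; elim/quotW=> z.
by rewrite -quot_piD !quot_piM -quot_piD mulrDr.
Qed.

HB.instance Definition _ := GRing.Zmodule_isPzRing.Build quot_ring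
  mulA mul1l mul1r mulDl mulDr.

Definition quot_pi (x : A) : quot_ring := \pi_quot_ring x.

Lemma quot_pi_is_zmod_morphism : zmod_morphism quot_pi.
Proof.
move=> x y; apply: (addIr (quot_pi y)).
by rewrite subrK /quot_pi -quot_piD subrK.
Qed.

Lemma quot_pi_is_monoid_morphism : monoid_morphism quot_pi.
Proof. by split=> [|x y] //; rewrite /quot_pi -quot_piM. Qed.

HB.instance Definition _ := GRing.isZmodMorphism.Build A quot_ring quot_pi
  quot_pi_is_zmod_morphism.
HB.instance Definition _ := GRing.isMonoidMorphism.Build A quot_ring quot_pi
  quot_pi_is_monoid_morphism.

Lemma quot_piP (x y : A) : quot_pi x = quot_pi y <-> I (x - y).
Proof. exact: quot_ringP. Qed.

End QuotientRing.

Definition von_neumann_regular (A : pzRingType) : Prop :=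
  forall a : A, exists b : A, a * b * a = a.

Definition idempotents_lift (A : pzRingType) (I : ideal A) : Prop :=
  forall e : quot_ring I, e * e = e ->
    exists f : A, f * f = f /\ quot_pi I f = e.

Definition injective_module (A : pzRingType) (E : lmodType A) : Prop :=
  forall (B C : lmodType A) (i : {linear B -> C}) (f : {linear B -> E}),
    injective i -> exists g : {linear C -> E}, forall x, g (i x) = f x.

(* As a left module over A^c, (A^c)^o is A acting on itself on the right.     *)
Definition right_self_injective (A : pzRingType) : Prop :=
  injective_module ((A^c)^o : rmodType A).

Section EndomorphismRing.
Variables (S : pzRingType) (M : lmodType S).

Definition endo : Type := {linear M -> M}.

HB.instance Definition _ := gen_eqMixin endo.
HB.instance Definition _ := gen_choiceMixin endo.

Lemma endoP (f g : endo) : f =1 g -> f = g.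
Proof.
case: f g => [f [[fD] [fZ]]] [g [[gD] [gZ]]] /= /funext fg.
by case: _ / fg in gD gZ *; congr (GRing.Linear.Pack (GRing.Linear.Class _ _));
  congr (_ _); exact: Prop_irrelevance.
Qed.

Let zero : endo := \0.
Let add (f g : endo) : endo := f \+ g.
Let opp (f : endo) : endo := \- f.
Let one : endo := idfun.
Let mul (f g : endo) : endo := f \o g.

Let addA : associative add.
Proof. by move=> f g h; apply: endoP => x; rewrite /= addrA. Qed.

Let addC : commutative add.
Proof. by move=> f g; apply: endoP => x; rewrite /= addrC. Qed.

Let add0 : left_id zero add.
Proof. by move=> f; apply: endoP => x; rewrite /= add0r. Qed.

Let addN : left_inverse zero opp add.
Proof. by move=> f; apply: endoP => x; rewrite /= addNr. Qed.

HB.instance Definition _ := GRing.isZmodule.Build endo addA addC add0 addN.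

Let mulA : associative mul.
Proof. by move=> f g h; apply: endoP. Qed.

Let mul1l : left_id one mul.
Proof. by move=> f; apply: endoP. Qed.

Let mul1r : right_id one mul.
Proof. by move=> f; apply: endoP. Qed.

Let mulDl : left_distributive mul +%R.
Proof. by move=> f g h; apply: endoP. Qed.

Let mulDr : right_distributive mul +%R.
Proof. by move=> f g h; apply: endoP => x; rewrite /= linearD. Qed.

HB.instance Definition _ := GRing.Zmodule_isPzRing.Build endo
  mulA mul1l mul1r mulDl mulDr.

Lemma endo0E x : (0 : endo) x = 0. Proof. by []. Qed.
Lemma endoDE (f g : endo) x : (f + g) x = f x + g x. Proof. by []. Qed.
Lemma endoNE (f : endo) x : (- f) x = - f x. Proof. by []. Qed.
Lemma endo1E x : (1 : endo) x = x. Proof. by []. Qed.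
Lemma endoME (f g : endo) x : (f * g) x = f (g x). Proof. by []. Qed.

Lemma endo_inverse (f : endo) : bijective f ->
  exists g : endo, g * f = 1 /\ f * g = 1.
Proof.
case=> g fK gK; pose gL := GRing.isLinear.Build S M M *:%R g (can2_linear fK gK).
pose g' : {linear M -> M} := HB.pack g gL.
by exists g'; split; apply: endoP => x /=; rewrite ?fK ?gK.
Qed.

End EndomorphismRing.

Section Envelopes.
Variables (R : pzRingType) (XX : rmodType R -> Prop).

Definition is_preenvelope (M X : rmodType R) (u : {linear M -> X}) : Prop :=
  XX X /\ forall (X' : rmodType R) (f : {linear M -> X'}), XX X' ->
    exists g : {linear X -> X'}, forall m, g (u m) = f m.

Definition is_envelope (M X : rmodType R) (u : {linear M -> X}) : Prop :=
  is_preenvelope u /\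
  forall h : endo X, (forall m, h (u m) = u m) -> bijective h.

Definition automorphism_invariant (M : rmodType R) : Prop :=
  exists (X : rmodType R) (u : {linear M -> X}), is_envelope u /\
    forall g : endo X, bijective g ->
      exists f : endo M, forall m, u (f m) = g (u m).

Definition closed_under_isomorphism : Prop :=
  forall (X Y : rmodType R) (f : {linear X -> Y}), bijective f -> XX X -> XX Y.

Section Phi.
Variables (M X : rmodType R) (u : {linear M -> X}) (envu : is_envelope u).

Lemma envelope_extension (f : endo M) :
  exists g : endo X, forall m, g (u m) = u (f m).
Proof.
have [[XX_X ext] _] := envu.
by have [g gu] := ext X (u \o f) XX_X; exists g.
Qed.

Lemma envelope_jacobson (h : endo X) :
  (forall m, h (u m) = 0) -> jacobson (endo X) h.
Proof.
move=> hu0 I [[I0 ID IM] InT Imax]; apply: contrapT => nIh.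
pose H := [set y : endo X | exists b, I (y - h * b)].
have sIH : I `<=` H by move=> y Iy; exists 0; rewrite mulr0 subr0.
have [|HI|HT] := Imax H _ sIH.
- split=> [|y z [b Ib] [c Ic]|y b [c Ic]]; first exact: sIH.
  + by exists (b + c); rewrite mulrDr opprD addrACA; apply: ID.
  + by exists (c * b); rewrite mulrA -mulrBl; apply: IM.
- by apply: nIh; rewrite -HI; exists 1; rewrite mulr1 subrr.
have [b Ib] : H 1 by rewrite HT.
have [|c [_ bhc]] := @endo_inverse _ _ (1 - b * h : endo X).
  by apply: envu.2 => m; rewrite endoDE endoNE endoME hu0 linear0 subr0.
have I1 : I 1.
  have <- : (1 - h * b) * (1 + h * c * b) = 1.
    rewrite mulrDr mulr1 mulrBl mul1r.
    have -> : h * b * (h * c * b) = h * ((b * h) * c) * b by rewrite !mulrA.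
    rewrite -mulrBl -mulrBr -[X in X - b * h * c]mul1r -mulrBl bhc mulr1.
    by rewrite subrK.
  exact: IM.
by move/eqP: InT; apply; apply/seteqP; split=> // y _; rewrite -(mul1r y); apply: IM.
Qed.

(* phi f is the class of a chosen extension of u \o f; by [phiE] any          *)
(* extension gives the same class.                                            *)
Definition phi (f : endo M) : quot_ring (jacobson_ideal (endo X)) :=
  quot_pi _ (projT1 (cid (envelope_extension f))).

Lemma phiE (f : endo M) (g : endo X) :
  (forall m, g (u m) = u (f m)) -> phi f = quot_pi _ g.
Proof.
move=> gu; rewrite /phi; case: cid => g' /= g'u; apply/quot_piP.
by apply: envelope_jacobson => m; rewrite endoDE endoNE gu g'u subrr.
Qed.

Lemma phi_is_zmod_morphism : zmod_morphism phi.
Proof.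
move=> f1 f2; have [g1 gu1] := envelope_extension f1.
have [g2 gu2] := envelope_extension f2.
rewrite (phiE gu1) (phiE gu2) -rmorphB; apply: phiE => m.
by rewrite !endoDE !endoNE linearB gu1 gu2.
Qed.

Lemma phi_is_monoid_morphism : monoid_morphism phi.
Proof.
split=> [|f1 f2]; first by rewrite (phiE (g := 1)) // rmorph1.
have [g1 gu1] := envelope_extension f1.
have [g2 gu2] := envelope_extension f2.
rewrite (phiE gu1) (phiE gu2) -rmorphM; apply: phiE => m.
by rewrite !endoME gu2 gu1.
Qed.

HB.instance Definition _ := GRing.isZmodMorphism.Build (endo M)
  (quot_ring (jacobson_ideal (endo X))) phi phi_is_zmod_morphism.
HB.instance Definition _ := GRing.isMonoidMorphism.Build (endo M)
  (quot_ring (jacobson_ideal (endo X))) phi phi_is_monoid_morphism.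

End Phi.
End Envelopes.

(* Main.v *)
(* Write S for End(X)/J(End(X)) and T for the image of phi. Every unit of S   *)
(* lifts to an automorphism of X, which restricts to M; so T is a subring of  *)
(* S containing all units, hence all square-zero elements. In S, Zorn's lemma *)
(* and self-injectivity give a largest isomorphism between two independent    *)
(* principal right ideals eS and fS. The corner of g = 1 - e - f is then      *)
(* abelian, and a largest isomorphism from a part of gS into eS leaves a      *)
(* central idempotent k with kS abelian, while (1 - k)S lies in the subring   *)
(* generated by the square-zero elements, hence in T. Every element of kS is  *)
(* a unit of kS times an idempotent, so T is regular. Finally, 1 - j is an    *)
(* automorphism of X for every j in J(End(X)), so it restricts to M: this     *)
(* gives K = J(End(M)), and it shows that an idempotent of End(X) congruent   *)
(* to an extension of an endomorphism of M maps M into M, so that idempotents *)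
(* lift.                                                                      *)

Require Import Defs.
From HB Require Import structures.
From mathcomp Require Import all_boot all_algebra.
From mathcomp Require Import boolp classical_sets.

Set Implicit Arguments.
Unset Strict Implicit.
Unset Printing Implicit Defensive.

Import GRing.Theory.
Local Open Scope ring_scope.
Local Open Scope classical_set_scope.

(** A homomorphism from a right ideal of a right self-injective ring [S] into [S] is a left
    multiplication ([functional_graph_mul]). So a Zorn-maximal isomorphism between independent right
    ideals yields matrix units [t], [m], and maximality rules out any further isomorphism beside
    them ([maximal_matrix_units]). Used twice, this splits [S] into an abelian central factor and a
    factor built from square-zero elements ([central_abelian_complement]), which makes every subring
    containing the units regular ([subring_with_units_regular]). The image of [phi] is such a
    subring, by [unit_mod_jacobson] and [automorphism_invariant_restrict]; the latter, applied to
    [1 - j] with [j] in the radical or to its inverse, also gives the other two conclusions. *)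

Lemma maximal_set_above (T : Type) (P : set (set T)) (A0 : set T) :
  P A0 ->
  (forall F : set (set T), F `<=` P -> total_on F subset -> F !=set0 ->
    P (\bigcup_(X in F) X)) ->
  exists A, [/\ P A, A0 `<=` A & forall B, P B -> A `<=` B -> B `<=` A].
Proof.
move=> PA0 chainP; pose P0 A := P A /\ A0 `<=` A.
(* [Zorn_bigcup] also asks for the union of the empty chain.                  *)
have [F FQ totF|A [QA maxA]] := @Zorn_bigcup T (fun A => A = set0 \/ P0 A).
  have [[X [FX [PX A0X]]]|nP] := pselect (exists X, F X /\ P0 X); last first.
    left; apply: bigcup0 => X FX.
    by have [//|PX] := FQ _ FX; case: nP; exists X.
  right; split; last by move=> x /A0X Xx; exists X.
  have -> : \bigcup_(Y in F) Y = \bigcup_(Y in F `&` P) Y.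
    apply/seteqP; split=> x [Y FY Yx]; last by exists Y => //; exact: FY.1.
    by have [Y0|[PY _]] := FQ _ FY; [rewrite Y0 in Yx|exists Y].
  by apply: chainP => [Y []|Y Z [FY _] [FZ _]|] //; [exact: totF|exists X].
have maxP0 B : P0 B -> A `<=` B -> B `<=` A.
  move=> PB AB; apply: contrapT => nBA.
  by apply: (maxA B); [exact: conj|right].
have [PA A0A] : P0 A.
  case: QA => // A_0.
  have A0A : A0 `<=` A by apply: maxP0; [split|rewrite A_0; exact: sub0set].
  split=> //; suff <- : A0 = A by [].
  by apply/seteqP; split=> //; rewrite A_0; exact: sub0set.
exists A; split=> // B PB AB; apply: maxP0 => //; split=> //.
exact: subset_trans AB.
Qed.

Lemma chain_right_ideal (A : pzRingType) (F : set (set A)) :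
  F `<=` @right_ideal A -> total_on F subset -> F !=set0 ->
  right_ideal (\bigcup_(X in F) X).
Proof.
move=> FI totF [X FX]; split.
- by exists X => //; have [] := FI _ FX.
- move=> x y [Y FY Yx] [Z FZ Zy]; have [YZ|ZY] := totF _ _ FY FZ.
    by exists Z => //; have [_ ZD _] := FI _ FZ; apply: ZD => //; exact: YZ.
  by exists Y => //; have [_ YD _] := FI _ FY; apply: YD => //; exact: ZY.
- by move=> x a [Y FY Yx]; exists Y => //; have [_ _ YM] := FI _ FY; exact: YM.
Qed.

Section Submodule.
Variables (A : pzRingType) (V : lmodType A) (P : submodClosed V).

(** [injective_module] quantifies over module types, so a submodule given by a predicate has to
    become a type. *)
Record submodule := Submodule {
  submodule_val : V;
  submodule_valP : submodule_val \in P
}.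

HB.instance Definition _ := [isSub for submodule_val].
HB.instance Definition _ := [Choice of submodule by <:].
HB.instance Definition _ := [SubChoice_isSubLmodule of submodule by <:].

Definition submodule_incl : {linear submodule -> V} := \val.

End Submodule.

Lemma linear_regularE (A : pzRingType) (g : {linear A^o -> A^o}) (x : A) :
  g x = x * g 1.
Proof. by rewrite -[in LHS](mulr1 x) -[x * 1]/(x *: (1 : A^o)) linearZ. Qed.

(** * Regular right self-injective rings: maximal partial isomorphisms *)

Section SelfInjective.
Variable S : pzRingType.
Hypotheses (regS : von_neumann_regular S) (injS : right_self_injective S).

(** The first projection embeds the module [G] into [S]; by injectivity the second one extends along
    it to an endomorphism of the right module [S], which is left multiplication by its value at
    1. *)
Lemma functional_graph_mul (G : set (S * S)) :
  G 0 -> (forall z w, G z -> G w -> G (z + w)) ->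
  (forall z a, G z -> G (z.1 * a, z.2 * a)) ->
  (forall z, G z -> z.1 = 0 -> z.2 = 0) ->
  exists s : S, forall z, G z -> z.2 = s * z.1.
Proof.
move=> G0 GD GM G1.
pose V : lmodType S^c := ((S^c)^o * (S^c)^o)%type.
pose P : {pred V} := fun z => `[< G z >].
have P_closed : submod_closed P.
  split=> [|a z w /asboolP Gz /asboolP Gw]; apply/asboolP => //.
  by apply: GD => //; exact: GM.
pose PG : submodClosed V :=
  HB.pack P (GRing.isSubmodClosed.Build S^c V P P_closed).
pose i : {linear submodule PG -> (S^c)^o} := fst \o submodule_incl PG.
pose f : {linear submodule PG -> (S^c)^o} := snd \o submodule_incl PG.
have i_inj : injective i.
  move=> x y ixy; have Gxy : G (val (x - y)).
    by apply/asboolP; exact: (submodule_valP (x - y)).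
  have xy1 : i (x - y) = 0 by rewrite linearB ixy subrr.
  have xy2 := G1 _ Gxy xy1.
  apply/eqP; rewrite -subr_eq0; apply/eqP/val_inj.
  by rewrite [LHS]surjective_pairing [X in (X, _)]xy1 [X in (_, X)]xy2.
have [g gE] := injS f i_inj.
exists (g 1) => z Gz.
have Pz : z \in PG by apply/asboolP.
have := gE (Submodule Pz); rewrite /i /f /= => <-.
exact: (@linear_regularE S^c g z.1).
Qed.

(** For [C] maximal among the right ideals independent of [L], the sum [L + C] is essential, and a
    regular ring is nonsingular. *)
Lemma right_complement (L : set S) : right_ideal L ->
  exists C : set S, [/\ right_ideal C, forall x, L x -> C x -> x = 0
    & forall s, (forall x, L x -> s * x = 0) -> (forall x, C x -> s * x = 0) ->
        s = 0].
Proof.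
move=> [L0 LD LM].
pose P C := right_ideal C /\ forall x, L x -> C x -> x = 0.
have [||C [[[C0 CD CM] LC] _ maxC]] := @maximal_set_above _ P [set 0].
- split=> [|//]; split=> // [x y /= -> ->|x a /= ->]; by rewrite ?addr0 ?mul0r.
- move=> F FP totF F0; split; last by move=> x Lx [Y /FP[_]]; apply.
  by apply: chain_right_ideal => // Y /FP[].
exists C; split=> // s sL sC; have [y sys] := regS s.
(* As [s] kills [L] and [C], adding [y * s] to [C] keeps it independent of [L]; by maximality
   [y * s] is in [C], so [s = s * (y * s) = 0]. *)
pose C' : set S := [set x | exists c r, C c /\ x = c + y * s * r].
have CC' : C `<=` C' by move=> c Cc; exists c, 0; rewrite mulr0 addr0.
have PC' : P C'.
  split; first split.
  - exact: CC'.
  - move=> _ _ [c [r [Cc ->]]] [d [t [Cd ->]]]; exists (c + d), (r + t).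
    by split; [exact: CD|rewrite mulrDr addrACA].
  - move=> _ a [c [r [Cc ->]]]; exists (c * a), (r * a).
    by split; [exact: CM|rewrite mulrDl !mulrA].
  move=> _ /[swap] -[c [r [Cc ->]]] Lx.
  have sr0 : s * r = 0.
    by rewrite -[RHS](sL _ Lx) mulrDr (sC c Cc) add0r !mulrA sys.
  by move: Lx; rewrite -mulrA sr0 mulr0 addr0 => Lc; exact: LC.
have : C (y * s) by apply: (maxC _ PC' CC'); exists 0, 1; rewrite mulr1 add0r.
by move/sC; rewrite mulrA sys.
Qed.

(* G is the graph of an isomorphism from a right ideal inside pS onto one     *)
(* inside qS; the last clause says that the two right ideals are independent  *)
(* and, taking z or w to be 0, that G and its inverse are functional.         *)
Definition partial_iso (p q : S) (G : set (S * S)) : Prop :=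
  [/\ G 0, forall z w, G z -> G w -> G (z + w),
      forall z a, G z -> G (z.1 * a, z.2 * a),
      forall z, G z -> p * z.1 = z.1 /\ q * z.2 = z.2
    & forall z w, G z -> G w -> z.1 + w.2 = 0 -> z = 0 /\ w = 0].

Lemma maximal_partial_iso (p q : S) :
  exists G, partial_iso p q G /\
    forall H, partial_iso p q H -> G `<=` H -> H `<=` G.
Proof.
have [||G [GP _ maxG]] := @maximal_set_above _ (partial_iso p q) [set 0];
  last by exists G.
  split=> // [z w -> ->|z a ->|z ->]; rewrite ?addr0 //=.
  - by rewrite !mul0r.
  - by rewrite !mulr0.
move=> F FP totF [X FX].
have common z w : (\bigcup_(Y in F) Y) z -> (\bigcup_(Y in F) Y) w ->
    exists Y, [/\ F Y, Y z & Y w].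
  move=> [Y FY Yz] [Z FZ Zw].
  by have [YZ|ZY] := totF _ _ FY FZ;
    [exists Z; split=> //; exact: YZ|exists Y; split=> //; exact: ZY].
split.
- by exists X => //; have [] := FP _ FX.
- move=> z w zF wF; have [Y [FY Yz Yw]] := common _ _ zF wF.
  by exists Y => //; have [_ YD _ _ _] := FP _ FY; exact: YD.
- by move=> z a [Y FY Yz]; exists Y => //; have [_ _ YM _ _] := FP _ FY; exact: YM.
- by move=> z [Y FY Yz]; have [_ _ _ Ypq _] := FP _ FY; exact: Ypq.
- move=> z w zF wF; have [Y [FY Yz Yw]] := common _ _ zF wF.
  by have [_ _ _ _] := FP _ FY; apply.
Qed.

(* With C a complement of dom G + ran G, the element t extends G and kills    *)
(* ran G and C, while m extends the inverse of G and kills dom G and C.       *)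
Lemma partial_iso_matrix_units (p q : S) (G : set (S * S)) :
  partial_iso p q G ->
  exists t m : S, [/\ t * t = 0, m * m = 0, t * m * t = t & m * t * m = m] /\
    (q * t = t /\ p * m = m) /\
    forall z, G z ->
      [/\ t * z.1 = z.2, t * z.2 = 0, m * z.1 = 0 & m * z.2 = z.1].
Proof.
move=> [G0 GD GM Gpq Gindep].
pose L : set S := [set x | exists z w, [/\ G z, G w & x = z.1 + w.2]].
have L_ideal : right_ideal L.
  split.
  - by exists 0, 0; split=> //; rewrite addr0.
  - move=> _ _ [z [w [Gz Gw ->]]] [z' [w' [Gz' Gw' ->]]].
    by exists (z + z'), (w + w'); split; [exact: GD|exact: GD|rewrite addrACA].
  - move=> _ a [z [w [Gz Gw ->]]].
    exists (z.1 * a, z.2 * a), (w.1 * a, w.2 * a).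
    by split; [exact: GM|exact: GM|rewrite mulrDl].
have [C [[C0 CD CM] LC0 ext0]] := right_complement L_ideal.
have CN x : C x -> C (- x) by move=> Cx; rewrite -mulrN1; exact: CM.
have indep z w c : G z -> G w -> C c -> z.1 + w.2 + c = 0 -> z = 0 /\ w = 0.
  move=> Gz Gw Cc /eqP; rewrite addr_eq0 => /eqP zwc.
  apply: Gindep => //; apply: LC0; first by exists z, w.
  by rewrite zwc; exact: CN.
(* The graph on [L + C] of the map sending [z.1 + w.2 + c] to [k z w], well defined by [indep];
   [k z w = z.2] will give [t], and [k z w = w.1] will give [m]. *)
pose H (k : S * S -> S * S -> S) : set (S * S) := [set x | exists z w c,
  [/\ G z, G w, C c & x = (z.1 + w.2 + c, k z w)]].
have HE (k : S * S -> S * S -> S) : k 0 0 = 0 ->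
    (forall z w z' w', k (z + z') (w + w') = k z w + k z' w') ->
    (forall z w a, k (z.1 * a, z.2 * a) (w.1 * a, w.2 * a) = k z w * a) ->
    exists s, forall z w c, G z -> G w -> C c -> s * (z.1 + w.2 + c) = k z w.
  move=> k0 kD kM; have [|x y|x a|x|s sE] := @functional_graph_mul (H k).
  - by exists 0, 0, 0; split=> //; rewrite k0 !addr0.
  - move=> [z [w [c [Gz Gw Cc ->]]]] [z' [w' [c' [Gz' Gw' Cc' ->]]]].
    exists (z + z'), (w + w'), (c + c'); split; [exact: GD|exact: GD|exact: CD|].
    by rewrite kD /=; congr (_, _); rewrite /= addrACA (addrACA z.1).
  - move=> [z [w [c [Gz Gw Cc ->]]]] /=.
    exists (z.1 * a, z.2 * a), (w.1 * a, w.2 * a), (c * a).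
    by split; [exact: GM|exact: GM|exact: CM|rewrite kM /= !mulrDl].
  - by move=> [z [w [c [Gz Gw Cc ->]]]] /= /indep[]// -> ->.
  exists s => z w c Gz Gw Cc.
  by have /sE/= <- : H k (z.1 + w.2 + c, k z w) by exists z, w, c.
have [t tE] := HE (fun z w => z.2)
  erefl (fun _ _ _ _ => erefl) (fun _ _ _ => erefl).
have [m mE] := HE (fun z w => w.1)
  erefl (fun _ _ _ _ => erefl) (fun _ _ _ => erefl).
have tG z : G z -> [/\ t * z.1 = z.2, t * z.2 = 0, m * z.1 = 0 & m * z.2 = z.1].
  move=> Gz; have := tE _ _ _ Gz G0 C0; have := tE _ _ _ G0 Gz C0.
  have := mE _ _ _ Gz G0 C0; have := mE _ _ _ G0 Gz C0.
  by rewrite /= !addr0 add0r.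
have tC c : C c -> t * c = 0 /\ m * c = 0.
  move=> Cc; have := tE _ _ _ G0 G0 Cc; have := mE _ _ _ G0 G0 Cc.
  by rewrite /= !add0r.
have ext s s' : (forall z, G z -> s * z.1 = s' * z.1 /\ s * z.2 = s' * z.2) ->
    (forall c, C c -> s * c = s' * c) -> s = s'.
  move=> sG sC; apply/eqP; rewrite -subr_eq0; apply/eqP/ext0 => x.
    move=> [z [w [/sG[z1 _] /sG[_ w2] ->]]].
    by rewrite mulrBl !mulrDr z1 w2 subrr.
  by move=> /sC xE; rewrite mulrBl xE subrr.
exists t, m; split; split => //.
- apply: ext => [z /tG[z1 z2 z3 z4]|c /tC[c1 c2]];
    last by rewrite -mulrA c1 mul0r mulr0.
  by rewrite -!mulrA z1 z2 !mul0r mulr0.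
- apply: ext => [z /tG[z1 z2 z3 z4]|c /tC[c1 c2]];
    last by rewrite -mulrA c2 mul0r mulr0.
  by rewrite -!mulrA z4 z3 !mul0r mulr0.
- apply: ext => [z /tG[z1 z2 z3 z4]|c /tC[c1 c2]];
    last by rewrite -mulrA c1 mulr0.
  by rewrite -!mulrA z1 z4 z1 z2 !mulr0.
- apply: ext => [z /tG[z1 z2 z3 z4]|c /tC[c1 c2]];
    last by rewrite -mulrA c2 mulr0.
  by rewrite -!mulrA z4 z1 z3 z4 !mulr0.
split; apply: ext => [z Gz|c /tC[c1 c2]]; rewrite -?mulrA ?c1 ?c2 ?mulr0 //.
- have [z1 z2 _ _] := tG _ Gz; have [_ z5] := Gpq _ Gz.
  by rewrite z1 z2 z5 mulr0.
- have [_ _ z3 z4] := tG _ Gz; have [z5 _] := Gpq _ Gz.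
  by rewrite z3 z4 z5 mulr0.
Qed.

(* The last clause is maximality: x could be added to t, with inverse y. The  *)
(* disjunctions allow replacing t by t * p and m by m * q.                    *)
Lemma maximal_matrix_units (p q : S) : p * p = p -> q * q = q ->
  p * q = 0 \/ p = 1 -> q * p = 0 \/ q = 1 ->
  exists t m : S, [/\ t * t = 0, m * m = 0, t * m * t = t & m * t * m = m] /\
    [/\ q * t = t, t * p = t, p * m = m & m * q = m] /\
    forall x y, t * x = 0 -> t * y = 0 -> m * x = 0 -> m * y = 0 ->
      x * x = 0 -> q * x = x -> p * y = y -> x * y * x = x -> x = 0.
Proof.
move=> pp qq pq0 qp0.
have [G [[G0 GD GM Gpq Gindep] maxG]] := maximal_partial_iso p q.
have [//|t [m [[tt mm tmt mtm] [[qt pm] tG]]]] := @partial_iso_matrix_units p q G.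
have tpt : t * p * t = 0.
  case: pq0 => [pq|->]; last by rewrite mulr1.
  by rewrite -[X in _ * X]qt mulrA -(mulrA t) pq mulr0 mul0r.
have mqm : m * q * m = 0.
  case: qp0 => [qp|->]; last by rewrite mulr1.
  by rewrite -[X in _ * X]pm mulrA -(mulrA m) qp mulr0 mul0r.
have tG' z : G z ->
    [/\ t * p * z.1 = z.2, t * p * z.2 = 0, m * q * z.1 = 0
      & m * q * z.2 = z.1].
  move=> Gz; have [z1 z2 z3 z4] := tG _ Gz; have [z5 z6] := Gpq _ Gz.
  rewrite -(mulrA t) z5 -(mulrA m q z.2) z6; split=> //.
    by case: pq0 => [pq|->]; rewrite ?mulr1// -z6 mulrA -(mulrA t) pq mulr0 mul0r.
  by case: qp0 => [qp|->]; rewrite ?mulr1// -z5 mulrA -(mulrA m) qp mulr0 mul0r.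
exists (t * p), (m * q); split; [split|split; [split|]].
- by rewrite mulrA tpt mul0r.
- by rewrite mulrA mqm mul0r.
- by rewrite -!mulrA (mulrA p) pm (mulrA q) qt !mulrA tmt.
- by rewrite -!mulrA (mulrA q) qt (mulrA p) pm !mulrA mtm.
- by rewrite mulrA qt.
- by rewrite -mulrA pp.
- by rewrite mulrA pm.
- by rewrite -mulrA qq.
move: (t * p) (m * q) tG' => {tpt mqm tmt mtm tt mm qt pm tG m}t m tG.
move=> x y tx ty mx my xx qx py xyx.
(* [G'] adjoins to [G] the isomorphism sending [y * x * a] to [x * a]. To see independence, multiply
   a relation by [t], [m] and then [x]. *)
pose G' : set (S * S) := [set v | exists z a,
  G z /\ v = (z.1 + y * x * a, z.2 + x * a)].
have GG' : G `<=` G'.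
  by move=> z Gz; exists z, 0; rewrite !mulr0 !addr0; case: z Gz.
have G'_iso : partial_iso p q G'.
  split; first exact: GG'.
  - move=> _ _ [z [a [Gz ->]]] [w [b [Gw ->]]]; exists (z + w), (a + b).
    split; first exact: GD.
    by congr (_, _); rewrite /= mulrDr addrACA.
  - move=> _ b [z [a [Gz ->]]]; exists (z.1 * b, z.2 * b), (a * b).
    by split; [exact: GM|rewrite /= !mulrDl !mulrA].
  - move=> _ [z [a [Gz ->]]]; have [z1 z2] := Gpq _ Gz.
    by rewrite /= !mulrDr z1 z2 !mulrA py qx.
  move=> _ _ [z [a [Gz ->]]] [w [b [Gw ->]]] /= E.
  have [z1 z2 z3 z4] := tG _ Gz; have [w1 w2 w3 w4] := tG _ Gw.
  have z20 : z.2 = 0.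
    have := congr1 ( *%R t) E.
    by rewrite !mulrDr z1 w2 !mulrA ty tx !mul0r !addr0 mulr0.
  have w10 : w.1 = 0.
    have := congr1 ( *%R m) E.
    by rewrite !mulrDr z3 w4 !mulrA my mx !mul0r !addr0 add0r mulr0.
  have [_ z0] : 0 = 0 :> S * S /\ z = 0 by apply: Gindep; rewrite ?add0r.
  have [w0 _] : w = 0 /\ 0 = 0 :> S * S by apply: Gindep; rewrite ?addr0.
  move: E; rewrite z0 w0 /= !add0r => E.
  have xa : x * a = 0.
    have := congr1 ( *%R x) E.
    by rewrite mulrDr !mulrA xyx xx mul0r addr0 mulr0.
  move: E; rewrite -mulrA xa mulr0 add0r => xb.
  by rewrite -mulrA xb mulr0.
have /tG[/= yxE _ _ _] : G (y * x, x).
  by apply: (maxG _ G'_iso GG'); exists 0, 1; rewrite !mulr1 !add0r.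
by rewrite -yxE mulrA ty mul0r.
Qed.

(** * Splitting off a central abelian factor *)

Lemma regular_semiprime (a b : S) :
  (forall s, a * s * b = 0) -> forall s, b * s * a = 0.
Proof.
move=> ab s; have [y <-] := regS (b * s * a).
have -> : b * s * a * y * (b * s * a) = b * s * (a * y * b) * s * a.
  by rewrite !mulrA.
by rewrite ab mulr0 !mul0r.
Qed.

(** A nonzero [(g - h) * s * h] would give an isomorphism from a part of [hS] onto a part of
    [(g - h)S], independent of what [t] and [m] match, against maximality. So the idempotents of the
    corner [gSg] are central in it. *)
Lemma abelian_corner : exists t m : S,
  [/\ t * t = 0, m * m = 0, t * m * t = t & m * t * m = m] /\
  let g := 1 - m * t - t * m in
  forall h s, h * h = h -> g * h = h -> h * g = h ->
    (g - h) * s * h = 0 /\ h * s * (g - h) = 0.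
Proof.
have [||||t [m [[tt mm tmt mtm] [_ maxtm]]]] :=
  @maximal_matrix_units 1 1.
- exact: mulr1.
- exact: mulr1.
- by right.
- by right.
exists t, m; split=> // g.
have tg : t * g = 0 by rewrite /g !mulrBr mulr1 !mulrA tmt tt mul0r subrr subr0.
have mg : m * g = 0 by rewrite /g !mulrBr mulr1 !mulrA mtm mm mul0r subr0 subrr.
have gt : g * t = 0 by rewrite /g !mulrBl mul1r tmt -mulrA tt mulr0 subr0 subrr.
have gm : g * m = 0 by rewrite /g !mulrBl mul1r mtm -mulrA mm mulr0 subrr subr0.
have gg : g * g = g.
  by rewrite {2}/g !mulrBr mulr1 !mulrA gm gt !mul0r !subr0.
clearbody g.
have ab h s : h * h = h -> g * h = h -> h * g = h -> (g - h) * s * h = 0.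
  move=> hh gh hg; set x := _ * h; have [y xyx] := regS x.
  have gx : g * x = x by rewrite /x !mulrA mulrBr gg gh.
  have xh : x * h = x by rewrite /x -mulrA hh.
  apply: (maxtm x (h * y)); rewrite ?mul1r //.
  - by rewrite -gx mulrA tg mul0r.
  - by rewrite -gh !mulrA tg !mul0r.
  - by rewrite -gx mulrA mg mul0r.
  - by rewrite -gh !mulrA mg !mul0r.
  - by rewrite -{1}xh -mulrA /x !(mulrA h) mulrBr hg hh subrr !mul0r mulr0.
  - by rewrite (mulrA x) xh.
move=> h s hh gh hg; split; first exact: ab.
(* The other half is the first one for the complementary idempotent [g - h]. *)
rewrite -[h in h * s](subKr g); apply: ab.
- by rewrite mulrBl !mulrBr gg gh hg hh subrr subr0.
- by rewrite mulrBr gg gh.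
- by rewrite mulrBl gg hg.
Qed.

(** Let [e2] be the largest part of the abelian corner [g] that embeds in [e], and [k = g - e2].
    Then [k] is orthogonal to [e2] because the corner is abelian, to [e] by maximality, and to [f]
    because [f = t * e * m]; hence [k] is central. *)
Lemma central_abelian_complement : exists k : S,
  [/\ k * k = k, forall s, k * s = s * k,
    forall h, h * h = h -> k * h = h -> forall s, h * s = s * h
  & forall T : set S, (forall x y, T x -> T y -> T (x + y)) ->
      (forall x y, T x -> T y -> T (x * y)) -> (forall x, x * x = 0 -> T x) ->
      forall s, T ((1 - k) * s)].
Proof.
have [t [m [[tt mm tmt mtm]]]] := abelian_corner.
set e := m * t; set f := t * m; set g := 1 - e - f => /= ab.
have ee : e * e = e by rewrite /e mulrA mtm.
have ff : f * f = f by rewrite /f mulrA tmt.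
have ef : e * f = 0 by rewrite /e /f mulrA -(mulrA m) tt mulr0 mul0r.
have fe : f * e = 0 by rewrite /e /f mulrA -(mulrA t) mm mulr0 mul0r.
have ge : g * e = 0 by rewrite /g !mulrBl mul1r ee fe subrr subr0.
have eg : e * g = 0 by rewrite /g !mulrBr mulr1 ee ef subrr subr0.
have gf : g * f = 0 by rewrite /g !mulrBl mul1r ff ef subr0 subrr.
have gg : g * g = g by rewrite {2}/g !mulrBr mulr1 ge gf !subr0.
have fE : f = t * e * m by rewrite /f /e mulrA tmt.
have eE : m * t = e by [].
have et : e * t = 0 by rewrite /e -mulrA tt mulr0.
have efg : 1 = e + f + g by rewrite /g -(addrA 1) -opprD subrKC.
clearbody g e f.
have [t2 [m2 [[tt2 mm2 tmt2 mtm2] [[et2 t2g gm2 m2e] max2]]]] :=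
  maximal_matrix_units gg ee (or_introl ge) (or_introl eg).
set e2 := m2 * t2 in max2 *.
have e2e2 : e2 * e2 = e2 by rewrite /e2 mulrA mtm2.
have ge2 : g * e2 = e2 by rewrite /e2 mulrA gm2.
have e2g : e2 * g = e2 by rewrite /e2 -mulrA t2g.
pose k := g - e2.
have [abl abr] : (forall s, k * s * e2 = 0) /\ (forall s, e2 * s * k = 0).
  by split=> s; have [] := ab _ s e2e2 ge2 e2g.
have kk : k * k = k by rewrite /k mulrBl !mulrBr gg ge2 e2g e2e2 subrr subr0.
have gk : g * k = k by rewrite /k mulrBr gg ge2.
have kg : k * g = k by rewrite /k mulrBl gg e2g.
have ke : k * e = 0 by rewrite -kg -mulrA ge mulr0.
have t2k : t2 * k = 0 by rewrite /k mulrBr t2g /e2 mulrA tmt2 subrr.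
have ek : e * k = 0 by rewrite -gk mulrA eg mul0r.
have t2e : t2 * e = 0 by rewrite -t2g -mulrA ge mulr0.
have m2k : m2 * k = 0 by rewrite -m2e -mulrA ek mulr0.
have eSk s : e * s * k = 0.
  set x := e * s * k; have [y xyx] := regS x.
  have xk : x * k = x by rewrite /x -mulrA kk.
  apply: (max2 x (k * y)).
  - by rewrite /x !mulrA t2e !mul0r.
  - by rewrite mulrA t2k mul0r.
  - by rewrite -(abr (m2 * e * s)) /e2 /x !mulrA mtm2.
  - by rewrite mulrA m2k mul0r.
  - by rewrite -{1}xk -mulrA /x !(mulrA k) ke !mul0r mulr0.
  - by rewrite /x !mulrA ee.
  - by rewrite mulrA gk.
  - by rewrite (mulrA x) xk.
have kSe := regular_semiprime eSk.
have k1 : 1 = e + f + e2 + k by rewrite efg /k -[RHS]addrA subrKC.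
have kC s : k * s = s * k.
  have -> : k * s = k * s * k.
    rewrite -[LHS]mulr1 k1 !mulrDr abl kSe.
    by rewrite fE !mulrA -(mulrA k s) kSe mul0r !add0r.
  rewrite -[RHS]mul1r k1 !mulrDl !mulrA abr eSk.
  by rewrite fE -!mulrA (mulrA m) (mulrA e) eSk mulr0 !add0r.
exists k; split=> //.
  move=> h hh kh s.
  have gh : g * h = h by rewrite -kh mulrA gk.
  have hk : h * k = h by rewrite -kC kh.
  have hg : h * g = h by rewrite -hk -mulrA kg.
  have [ghs hgs] := ab h s hh gh hg.
  have hsg : h * s * g = h * s.
    by rewrite -[in LHS]hk -(mulrA h k s) kC mulrA -[LHS]mulrA kg -mulrA -kC mulrA hk.
  have gsh : g * s * h = s * h.
    by rewrite -{1}kh mulrA -(mulrA g s) -kC mulrA gk kC -mulrA kh.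
  have := ghs; rewrite !mulrBl gsh => /eqP; rewrite subr_eq0 => /eqP ->.
  by have := hgs; rewrite !mulrBr hsg => /eqP; rewrite subr_eq0 => /eqP.
move=> T TD TM Tn s.
have -> : 1 - k = e + f + e2 by rewrite k1 addrK.
have sq a b : b * a = 0 -> forall r, T (a * r * b).
  move=> ba r; apply: Tn; rewrite !mulrA -(mulrA _ b a) ba mulr0.
  by rewrite !mul0r.
have Tt : T t by exact: Tn.
have Tm : T m by exact: Tn.
have Te r : T (e * r).
  (* The first term squares to zero, and so do both factors [m] and [t * (e * r * e)] of the second.
     The parts [f] and [e2] then follow from [f = t * e * m] and [t2 = e * t2]. *)
  have -> : e * r = e * r * (1 - e) + m * (t * (e * r * e)).
    by rewrite mulrBr mulr1 !mulrA eE ee subrK.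
  apply: TD; first by apply: sq; rewrite mulrBl mul1r ee subrr.
  apply: TM => //; rewrite !mulrA; apply: Tn.
  by rewrite !mulrA -(mulrA _ e t) et mulr0 !mul0r.
rewrite !mulrDl; apply: (TD); first apply: (TD) => //.
  by rewrite fE -!mulrA; apply: TM.
rewrite /e2 -mulrA -[t2]et2 -mulrA; apply: TM => //; exact: Tn.
Qed.

(* On the abelian part kS, a = k x has a group inverse w: a w = w a = h with  *)
(* h a central idempotent, and w + (1 - h) is a unit, hence lies in T.        *)
Lemma subring_with_units_regular (T : set S) :
  (forall x y, T x -> T y -> T (x + y)) ->
  (forall x y, T x -> T y -> T (x * y)) ->
  (forall v w, v * w = 1 -> w * v = 1 -> T v) ->
  forall x, T x -> exists2 y, T y & x * y * x = x.
Proof.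
move=> TD TM TU x Tx.
have TN1 : T (-1) by apply: (TU _ (-1)); rewrite mulrNN mulr1.
have Tsq n : n * n = 0 -> T n.
  move=> nn; rewrite -[n](addrK 1); apply: TD => //.
  apply: (TU _ (1 - n)).
    by rewrite mulrDl mul1r mulrBr mulr1 nn subr0 subrKC.
  by rewrite mulrBl mul1r mulrDr mulr1 nn add0r addrC addKr.
have TB a b : T a -> T b -> T (a - b).
  by move=> Ta Tb; rewrite -mulrN1; apply: TD => //; exact: TM.
have [k [kk kC kab /(_ T TD TM Tsq) Tk]] := central_abelian_complement.
have [b xbx] := regS x.
pose a := k * x; pose y := k * b.
have ya : y * a = k * (b * x).
  by rewrite /y /a mulrA -(mulrA k b) -kC mulrA kk -mulrA.
have ay : a * y = k * (x * b).
  by rewrite /y /a mulrA -(mulrA k x) -kC mulrA kk -mulrA.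
have aya : a * y * a = a.
  by rewrite ay /a -mulrA (mulrA (x * b)) -kC -mulrA xbx mulrA kk.
pose h := y * a.
have hh : h * h = h by rewrite /h mulrA -(mulrA y a) -mulrA aya.
have kh : k * h = h by rewrite /h ya mulrA kk.
pose h' := a * y.
have h'h' : h' * h' = h' by rewrite /h' mulrA aya.
have kh' : k * h' = h' by rewrite /h' ay mulrA kk.
have hC := kab _ hh kh; have h'C := kab _ h'h' kh'.
have ah : a * h = a by rewrite /h mulrA aya.
have ha : h * a = a by rewrite hC.
have h'a : h' * a = a by [].
(* Both idempotents are central and fix [a], so both equal [h' * h]. *)
have hh' : h = h'.
  have -> : h = h' * h by rewrite {1}/h -{1}h'a mulrA -h'C -mulrA.
  by rewrite -hC /h' mulrA ha.
pose w := y * h.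
have aw : a * w = h by rewrite /w mulrA -/h' -hh' hh.
have wa : w * a = h by rewrite /w -mulrA ha.
have wh : w * h = w by rewrite /w -mulrA hh.
have hw : h * w = w by rewrite hC.
have c1 x0 : x0 * h = x0 -> x0 * (1 - h) = 0.
  by move=> x0h; rewrite mulrBr mulr1 x0h subrr.
have c2 x0 : h * x0 = x0 -> (1 - h) * x0 = 0.
  by move=> hx0; rewrite mulrBl mul1r hx0 subrr.
have cc : (1 - h) * (1 - h) = 1 - h by rewrite mulrBr mulr1 (c2 h hh) subr0.
pose v := w + (1 - h).
have Tv : T v.
  apply: (TU _ (a + (1 - h))); rewrite /v mulrDl mulrDr (mulrDr (1 - h)) cc.
    by rewrite wa (c1 _ wh) (c2 _ ha) addr0 add0r subrKC.
  by rewrite aw (c1 _ ah) (c2 _ hw) addr0 add0r subrKC.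
have ava : a * v * a = a.
  by rewrite -mulrA /v mulrDl wa (c2 _ ha) addr0.
(* The unit [v] serves on [kS]; on [(1 - k)S], which lies in [T], any quasi-inverse [b] will do. *)
exists (k * v + (1 - k) * b).
  apply: TD => //; have -> : k * v = v - (1 - k) * v.
    by rewrite mulrBl mul1r subKr.
  exact: TB.
have -> : x * (k * v + (1 - k) * b) * x = a * v * a + (1 - k) * (x * b * x).
  rewrite mulrDr mulrDl; congr (_ + _).
    by rewrite /a mulrA -kC -!mulrA (mulrA v) -kC -!mulrA (mulrA x k) -kC !mulrA kk.
  have kxC : x * (1 - k) = (1 - k) * x by rewrite mulrBr mulr1 mulrBl mul1r kC.
  by rewrite !mulrA kxC.
by rewrite xbx ava /a mulrBl mul1r subrKC.
Qed.

End SelfInjective.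


(** * The Jacobson radical and units *)

Section Jacobson.
Variable A : pzRingType.

(** Otherwise [(1 - x)A] lies in a maximal right ideal, which contains [x] too, hence 1. *)
Lemma jacobson_right_inverse (x : A) : jacobson A x ->
  exists b, (1 - x) * b = 1.
Proof.
move=> Jx; apply: contrapT => ninv.
pose P I := right_ideal I /\ ~ I (1 : A).
pose L : set A := [set y | exists b, y = (1 - x) * b].
have [||I [[[I0 ID IM] nI1] LI maxI]] := @maximal_set_above _ P L.
- split; last by case=> b bE; apply: ninv; exists b.
  split=> [|_ _ [b ->] [c ->]|_ a [b ->]].
  + by exists 0; rewrite mulr0.
  + by exists (b + c); rewrite mulrDr.
  + by exists (b * a); rewrite mulrA.
- move=> F FP totF F0; split; last by move=> [Z /FP[_ nZ1]].
  by apply: chain_right_ideal => // Y /FP[].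
apply: (nI1); rewrite -(subrK x 1); apply: (ID).
  by apply: LI; exists 1; rewrite mulr1.
apply: Jx; split=> // [|L' L'_ideal IL'].
  by apply/eqP => IT; apply: nI1; rewrite IT.
have [L'1|nL'1] := pselect (L' 1).
  right; apply/seteqP; split=> // y _; rewrite -(mul1r y).
  by case: L'_ideal => _ _; apply.
by left; apply/seteqP; split=> //; exact: maxI.
Qed.

(** A right inverse [b] equals [1 + x * b], so it has a right inverse itself, which must be
    [1 - x]. *)
Lemma jacobson_unit (x : A) : jacobson A x ->
  exists b, b * (1 - x) = 1 /\ (1 - x) * b = 1.
Proof.
move=> Jx; have [b xb] := jacobson_right_inverse Jx.
have [c bc] : exists c, b * c = 1.
  have [_ _ JM] := right_ideal_jacobson A.
  have [c] := jacobson_right_inverse (JM _ (- b) Jx); rewrite mulrN opprK.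
  have -> : 1 + x * b = b by rewrite -{1}xb -mulrDl subrK mul1r.
  by exists c.
exists b; split=> //.
have cE : (1 - x) * b * c = 1 - x by rewrite -mulrA bc mulr1.
have <- : c = 1 - x by rewrite -cE xb mul1r.
exact: bc.
Qed.

Lemma right_inverse_jacobson (x : A) :
  (forall a, exists b, (1 - x * a) * b = 1) -> jacobson A x.
Proof.
move=> xinv I [[I0 ID IM] /eqP InT Imax]; apply: contrapT => nIx.
have nI1 : ~ I 1.
  by move=> I1; apply/InT/seteqP; split=> // y _; rewrite -(mul1r y); exact: IM.
pose H := [set y : A | exists b, I (y - x * b)].
have IH : I `<=` H by move=> y Iy; exists 0; rewrite mulr0 subr0.
have [|HI|HT] := Imax H _ IH.
- split=> [|y z [b Ib] [c Ic]|y b [c Ic]]; first exact: IH.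
  + by exists (b + c); rewrite mulrDr opprD addrACA; exact: ID.
  + by exists (c * b); rewrite mulrA -mulrBl; exact: IM.
- by apply: nIx; rewrite -HI; exists 1; rewrite mulr1 subrr.
have [a Ia] : H 1 by rewrite HT.
by have [b xab] := xinv a; apply: nI1; rewrite -xab; exact: IM.
Qed.

End Jacobson.

(** Both [a * b] and [b * a] are 1 modulo the radical, hence units, so [a] is invertible on either
    side. *)
Lemma unit_mod_jacobson (A : pzRingType) (a b : A) :
  let pi := quot_pi (jacobson_ideal A) in
  pi a * pi b = 1 -> pi b * pi a = 1 -> exists c, c * a = 1 /\ a * c = 1.
Proof.
move=> pi.
have inv (x y : A) : pi x * pi y = 1 ->
    exists c, c * (x * y) = 1 /\ x * y * c = 1.
  rewrite -rmorphM -(rmorph1 pi) => /esym/quot_piP.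
  by move=> /jacobson_unit; rewrite subKr.
move=> /inv[c [_ abc]] /inv[d [dba _]]; exists (d * b); rewrite -mulrA; split=> //.
suff -> : d * b = b * c by rewrite mulrA.
by rewrite -[LHS]mulr1 -abc !mulrA -[d * b * a]mulrA dba mul1r.
Qed.

Lemma quot_pi_surj (A : pzRingType) (I : ideal A) (x : quot_ring I) :
  exists a, quot_pi I a = x.
Proof. by elim/quotW: x => a; exists a. Qed.

(** * Restricting automorphisms of an envelope *)

Section Envelope.
Variables (R : pzRingType) (XX : rmodType R -> Prop).

Lemma endo_unit_bij (M : rmodType R) (g h : endo M) :
  h * g = 1 -> g * h = 1 -> bijective g.
Proof.
move=> hg gh; exists h => x; rewrite -endoME ?hg ?gh //.
Qed.

Lemma bij_of_comp_bij (T U : Type) (s : T -> U) (t : U -> T) :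
  bijective (t \o s) -> bijective (s \o t) -> bijective s.
Proof.
move=> [r rK Kr] [r' r'K Kr']; exists (r \o t) => [x|y] /=; first exact: rK.
by rewrite -[y]Kr' /=; congr s; exact: rK.
Qed.

(* The envelope witnessing the invariance of M need not be u.                 *)
Lemma automorphism_invariant_restrict (M X : rmodType R) (u : {linear M -> X}) :
  is_envelope XX u -> automorphism_invariant XX M ->
  forall g : endo X, bijective g ->
    exists f : endo M, forall m, u (f m) = g (u m).
Proof.
move=> [[XX_X uext] ubij] [X' [u' [[[XX_X' u'ext] u'bij] inv]]] g gbij.
have [s su] := uext X' u' XX_X'; have [t tu'] := u'ext X u XX_X.
pose ts : endo X := t \o s; pose st : endo X' := s \o t.
have ts_bij : bijective ts by apply: ubij => m; rewrite /= su tu'.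
have st_bij : bijective st by apply: u'bij => m; rewrite /= tu' su.
have s_bij : bijective s by apply: (bij_of_comp_bij ts_bij st_bij).
have t_bij : bijective t by apply: (bij_of_comp_bij st_bij ts_bij).
have [r [rts tsr]] := endo_inverse ts_bij.
have ru m : r (u m) = u m.
  have tsu : ts (u m) = u m by rewrite /= su tu'.
  by rewrite -{1}tsu -endoME rts endo1E.
have r_bij : bijective r := endo_unit_bij tsr rts.
(* Since [r \o t] is the inverse of [s], this is [g] conjugated by [s]. *)
pose g' : endo X' := s \o (g \o (r \o t)).
have g'_bij : bijective g'.
  by apply: (bij_comp s_bij); apply: (bij_comp gbij); exact: bij_comp.
have [f fE] := inv g' g'_bij; exists f => m; apply: (bij_inj s_bij).
by rewrite su fE /= tu' ru.
Qed.

End Envelope.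

(** * Transfer from the envelope to the module *)

Theorem theorem3p8 (R : pzRingType) (XX : rmodType R -> Prop)
    (XX_nonempty : exists X0 : rmodType R, XX X0)
    (XX_iso : closed_under_isomorphism XX)
    (M X : rmodType R) (u : {linear M -> X})
    (u_env : is_envelope XX u) (u_mono : injective u)
    (regX : von_neumann_regular (quot_ring (jacobson_ideal (endo X))))
    (injX : right_self_injective (quot_ring (jacobson_ideal (endo X))))
    (liftX : idempotents_lift (jacobson_ideal (endo X)))
    (invM : automorphism_invariant XX M) :
  let K := kernel_ideal (phi u_env) in
  [/\ von_neumann_regular (quot_ring K),
      ideal_set K = jacobson (endo M)
    & idempotents_lift (jacobson_ideal (endo M))].
Proof.
move=> K; have restr := automorphism_invariant_restrict u_env invM.
have ext := envelope_extension u_env.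
have piJ (h : endo X) :
    jacobson _ h <-> quot_pi (jacobson_ideal (endo X)) h = 0.
  by rewrite -(rmorph0 (quot_pi (jacobson_ideal (endo X)))) quot_piP subr0.
have regM f : exists f', phi u_env (f * f' * f - f) = 0.
  pose T := range (phi u_env).
  have [||||_ [f' _ <-]] :=
    @subring_with_units_regular _ regX injX T _ _ _ (phi u_env f).
  - by move=> _ _ [a _ <-] [b _ <-]; exists (a + b) => //; rewrite rmorphD.
  - by move=> _ _ [a _ <-] [b _ <-]; exists (a * b) => //; rewrite rmorphM.
  - move=> v w; have [g <-] := quot_pi_surj v; have [h <-] := quot_pi_surj w.
    move=> /unit_mod_jacobson/[apply] -[c [cg gc]].
    have gbij := endo_unit_bij cg gc.
    have [f' f'E] := restr g gbij; exists f' => //.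
    by apply: phiE => m; rewrite f'E.
  - by exists f.
  by move=> fE; exists f'; rewrite rmorphB !rmorphM fE subrr.
have KJ f : phi u_env f = 0 <-> jacobson (endo M) f.
  split=> [Kf|Jf]; last first.
    have [f' Kf'] := regM f.
    have [_ _ JM] := right_ideal_jacobson (endo M).
    have [c [cf _]] := jacobson_unit (JM _ f' Jf).
    (* Here [c] inverts [1 - f * f'], and [f * f' * f - f] is in the kernel by regularity. *)
    have -> : f = - (c * (f * f' * f - f)).
      have : c * ((1 - f * f') * f) = f by rewrite mulrA cf mul1r.
      by rewrite mulrBl mul1r => cE; rewrite -[LHS]cE -[in LHS]opprB mulrN.
    by rewrite rmorphN rmorphM /= Kf' mulr0 oppr0.
  apply: right_inverse_jacobson => a.
  (* [g] lies in the radical, so [1 - g] is an automorphism; its inverse restricts to a right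
     inverse of [1 - f * a]. *)
  have [g gE] := ext (f * a).
  have /piJ/jacobson_unit[h [hg gh]] : quot_pi (jacobson_ideal (endo X)) g = 0.
    by rewrite -(phiE u_env gE) rmorphM /= Kf mul0r.
  have [f' f'E] := restr h (endo_unit_bij gh hg); exists f'.
  apply: endoP => m; apply: u_mono.
  rewrite endoME endoDE endoNE linearB -gE f'E.
  by rewrite -[RHS](endo1E (u m)) -gh endoME.
split.
- move=> a; have [f <-] := quot_pi_surj a; have [f' Kf'] := regM f.
  by exists (quot_pi K f'); rewrite -!rmorphM; exact/quot_piP.
- by apply/seteqP; split=> f /KJ.
move=> a; have [f <-] := quot_pi_surj a; rewrite -rmorphM => /quot_piP/KJ Kf.
have [|p [pp pE]] := liftX (phi u_env f).
  by apply/eqP; rewrite -rmorphM -subr_eq0 -rmorphB /= Kf.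
have [g gE] := ext f.
have /quot_piP Jgp : quot_pi (jacobson_ideal (endo X)) g = quot_pi _ p.
  by rewrite pE (phiE u_env gE).
have [h [hg gh]] := jacobson_unit Jgp.
have [f1 f1u] := restr _ (endo_unit_bij hg gh).
have f1E m : u (f1 m) = u m - (g - p) (u m) by rewrite f1u.
(* On the image of [u] this acts as [1 - (g - p) - 1 + g = p], so [e] is the restriction of the
   idempotent [p]. *)
pose e : endo M := f1 - 1 + f.
have eE m : u (e m) = p (u m).
  rewrite /e !endoDE endoNE endo1E linearD linearB f1E -gE endoDE endoNE.
  by rewrite opprB (addrC (u m)) addrK subrK.
exists e; split.
  by apply: endoP => m; apply: u_mono; rewrite endoME !eE -endoME pp.
apply/quot_piP/KJ; rewrite /e addrK.
have ->: phi u_env (f1 - 1) = quot_pi _ (- (g - p)).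
  apply: phiE => m.
  have -> : (f1 - 1 : endo M) m = f1 m - m by [].
  by rewrite linearB f1E endoNE addrAC subrr add0r.
by move/piJ: Jgp => Jgp; rewrite rmorphN /= Jgp oppr0.
Qed.
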